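(* There exist absolute constants $c>0$ and $M$ such that for every instance of the packing disjoint bilinear program $z_{\mathrm{PDB}}=\max\{\mathbf x^T\mathbf y\mid\mathbf x\in\mathcal X,\mathbf y\in\mathcal Y\}$ (defined in the context) with $m_1,m_2\ge M$, there exist a feasible solution $(\tilde{\mathbf x},\tilde{\mathbf y})\in\mathcal X\times\mathcal Y$ and reals $\zeta_1,\zeta_2$ with $1\le\zeta_1\le\zeta_1^*$ and $1\le\zeta_2\le\zeta_2^*$ such that $\tilde x_i\in\{0,\theta_i/\zeta_1\}$ and $\tilde y_i\in\{0,\gamma_i/\zeta_2\}$ for all $i\in[n]$, and $$\tilde{\mathbf x}^T\tilde{\mathbf y}\ \ge\ c\cdot\frac{\log\log m_1}{\log m_1}\cdot\frac{\log\log m_2}{\log m_2}\cdot z_{\mathrm{PDB}}.$$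
   Context: $\mathcal X=\{\mathbf x\in\mathbb R^n\mid\mathbf x\ge\mathbf 0,\ \mathbf P\mathbf x\le\mathbf p\}$ and $\mathcal Y=\{\mathbf y\in\mathbb R^n\mid\mathbf y\ge\mathbf 0,\ \mathbf Q\mathbf y\le\mathbf q\}$, where $\mathbf P\in\mathbb R_+^{m_1\times n}$, $\mathbf Q\in\mathbb R_+^{m_2\times n}$, $\mathbf p\in\mathbb R_+^{m_1}$, $\mathbf q\in\mathbb R_+^{m_2}$; $\mathcal X,\mathcal Y$ are polytopes (bounded). For $i\in[n]$, $\theta_i=\max_{\mathbf x\in\mathcal X}x_i$ and $\gamma_i=\max_{\mathbf y\in\mathcal Y}y_i$. Finally $$\zeta_1^*=\frac{3\log m_1}{\log\log m_1}+2,\qquad\zeta_2^*=\frac{3\log m_2}{\log\log m_2}+2.$$ *)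

(* Defs.v *)
From mathcomp Require Import all_boot all_order all_algebra.
From mathcomp Require Import all_classical all_reals all_analysis.

Set Implicit Arguments.
Unset Strict Implicit.
Unset Printing Implicit Defensive.

Import Order.TTheory GRing.Theory Num.Theory.
Import numFieldNormedType.Exports.

Local Open Scope classical_set_scope.
Local Open Scope ring_scope.

Definition lemx (R : realType) (m n : nat) (A B : 'M[R]_(m, n)) : Prop :=
  forall i j, A i j <= B i j.

Definition packing (R : realType) (m n : nat) (P : 'M[R]_(m, n)) (p : 'cV[R]_m)
    : set 'cV[R]_n :=
  [set x | lemx 0 x /\ lemx (P *m x) p].

Definition dotcv (R : realType) (n : nat) (x y : 'cV[R]_n) : R :=
  (x^T *m y) ord0 ord0.

(* The two suprema below are maxima for the bounded packing polyhedra they are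
   used on: see [coord_max_attained] and [zPDB_attained]. *)
Definition coord_max (R : realType) (n : nat) (X : set 'cV[R]_n) (i : 'I_n) : R :=
  sup [set x i ord0 | x in X].

Definition zPDB (R : realType) (n : nat) (X Y : set 'cV[R]_n) : R :=
  sup [set dotcv x y | x in X & y in Y].

Definition zeta_star (R : realType) (m : nat) : R :=
  3 * ln m%:R / ln (ln m%:R) + 2.

Lemma trmx_continuous (R : realType) (m n : nat) :
  continuous (fun x : 'M[R]_(m, n) => x^T).
Proof.
move=> x A [B nB BA]; exists (fun i j => B j i) => [i j|y By].
  by have := nB j i; rewrite mxE.
by apply: BA => i j; rewrite mxE; exact: By.
Qed.

Lemma sup_attained (R : realType) (T : topologicalType) (f : T -> R) (A : set T) :
  A !=set0 -> compact A -> continuous f ->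
  exists2 c, A c & f c = sup (f @` A) /\ forall t, A t -> f t <= sup (f @` A).
Proof.
move=> A0 cA cf.
have [c /set_mem Ac fc] := compact_EVT_max A0 cA (continuous_subspaceT cf).
have ub : ubound (f @` A) (f c) by move=> _ [t At <-]; apply: fc; exact: mem_set.
have fcE : f c = sup (f @` A).
  apply/eqP; rewrite eq_le; apply/andP; split.
    by apply: ub_le_sup; [exists (f c)|exists c].
  by apply: ge_sup => //; exists (f c), c.
by exists c => //; split=> // t At; rewrite -fcE; apply: fc; exact: mem_set.
Qed.

Lemma closed_le_continuous (R : realType) (T : topologicalType) (f : T -> R) (a : R) :
  continuous f -> closed [set x | f x <= a].
Proof.
move=> cf; rewrite (_ : [set x | _] = f @^-1` [set y | y <= a]) //.
by apply: preimage_closed => [x _|]; [exact: cf|exact: closed_le].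
Qed.

Lemma mulmx_coord_continuous (R : realType) (m n : nat) (P : 'M[R]_(m, n)) i :
  continuous (fun x : 'cV[R]_n => (P *m x) i ord0).
Proof.
rewrite (_ : (fun x : 'cV[R]_n => _) =
    (fun x : 'cV[R]_n => \sum_k P i k * x k ord0)); last first.
  by apply/funext => y; rewrite mxE.
apply: continuous_big => [|k _ x]; first exact: add_continuous.
apply: (continuousM (s := fun=> P i k)); first exact: cst_continuous.
exact: coord_continuous.
Qed.

Lemma packing_closed (R : realType) (m n : nat) (P : 'M[R]_(m, n)) (p : 'cV[R]_m) :
  closed (packing P p).
Proof.
rewrite (_ : packing P p =
    (\bigcap_(i in [set: 'I_n]) [set x : 'cV[R]_n | - x i ord0 <= 0]) `&`
    (\bigcap_(i in [set: 'I_m]) [set x : 'cV[R]_n | (P *m x) i ord0 <= p i ord0])); last first.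
  apply/seteqP; split => x [h1 h2]; split => i.
  - by move=> _ /=; rewrite oppr_le0; have := h1 i ord0; rewrite mxE.
  - by move=> _; exact: h2.
  - by move=> j; have := h1 i I; rewrite /= oppr_le0 mxE (ord1 j).
  - by move=> j; rewrite (ord1 j); exact: h2 i I.
apply: closedI; apply: closed_bigI => i _; apply: closed_le_continuous.
- by move=> x; exact: (continuousN (@coord_continuous R n 1 i ord0 x)).
- exact: mulmx_coord_continuous.
Qed.

Lemma packing_compact (R : realType) (m n : nat) (P : 'M[R]_(m, n)) (p : 'cV[R]_m) :
  bounded_set (packing P p) -> compact (packing P p).
Proof.
move=> bX; set X := packing P p.
pose Z : set 'rV[R]_n := (fun x : 'rV[R]_n => x^T) @^-1` X.
have -> : X = (fun x : 'rV[R]_n => x^T) @` Z.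
  apply/seteqP; split => x; first by move=> Xx; exists x^T; rewrite /Z/= trmxK.
  by case=> y + <-.
apply: continuous_compact.
  by apply: continuous_subspaceT; exact: trmx_continuous.
apply: bounded_closed_compact.
  case: bX => M [Mr bM]; exists (Num.max M 0); split; first exact: num_real.
  move=> a aM y Zy /=.
  have aM' : M < a by rewrite (le_lt_trans _ aM)// le_max lexx.
  have a0 : 0 <= a by rewrite ltW// (le_lt_trans _ aM)// le_max lexx orbT.
  have := bM a aM' _ Zy => /=.
  rewrite [`|y^T|]mx_normrE [`|y|]mx_normrE => h.
  apply: bigmax_le => // -[i j] _ /=; apply: le_trans h.
  have -> : y i j = y^T j i by rewrite mxE.
  exact: (le_bigmax _ (fun k : 'I_n * 'I_1 => `|y^T k.1 k.2|) (j, i)).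
by apply: preimage_closed => [x _|]; [exact: trmx_continuous|exact: packing_closed].
Qed.

Lemma packing0 (R : realType) (m n : nat) (P : 'M[R]_(m, n)) (p : 'cV[R]_m) :
  lemx 0 p -> packing P p 0.
Proof. by move=> p0; split=> //; rewrite mulmx0. Qed.

Lemma coord_max_attained (R : realType) (m n : nat) (P : 'M[R]_(m, n))
    (p : 'cV[R]_m) (i : 'I_n) :
  lemx 0 p -> bounded_set (packing P p) ->
  exists2 x, packing P p x &
    x i ord0 = coord_max (packing P p) i /\
    forall x', packing P p x' -> x' i ord0 <= coord_max (packing P p) i.
Proof.
move=> p0 bX; apply: sup_attained; last exact: coord_continuous.
- by exists 0; exact: packing0.
- exact: packing_compact.
Qed.

Lemma zPDB_attained (R : realType) (m1 m2 n : nat)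
    (P : 'M[R]_(m1, n)) (p : 'cV[R]_m1) (Q : 'M[R]_(m2, n)) (q : 'cV[R]_m2) :
  lemx 0 p -> bounded_set (packing P p) ->
  lemx 0 q -> bounded_set (packing Q q) ->
  exists x y, [/\ packing P p x, packing Q q y,
    dotcv x y = zPDB (packing P p) (packing Q q) &
    forall x' y', packing P p x' -> packing Q q y' ->
      dotcv x' y' <= zPDB (packing P p) (packing Q q)].
Proof.
move=> p0 bX q0 bY; set X := packing P p; set Y := packing Q q.
pose f (u : 'cV[R]_n * 'cV[R]_n) := dotcv u.1 u.2.
have cf : continuous f.
  rewrite (_ : f = fun u => \sum_k u.1 k ord0 * u.2 k ord0); last first.
    by apply/funext => v; rewrite /f /dotcv mxE; apply: eq_bigr => k _; rewrite mxE.
  apply: continuous_big => [|k _ u]; first exact: add_continuous.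
  pose g (x : 'cV[R]_n) := x k ord0.
  have cg : continuous g by exact: coord_continuous.
  apply: (continuousM (s := g \o fst) (t := g \o snd)).
    by apply: continuous_comp; [exact: cvg_fst|exact: cg].
  by apply: continuous_comp; [exact: cvg_snd|exact: cg].
have XY0 : (X `*` Y) !=set0 by exists (0, 0); split; exact: packing0.
have cXY : compact (X `*` Y) by apply: compact_setX; exact: packing_compact.
have zE : zPDB X Y = sup (f @` (X `*` Y)).
  congr sup; apply/seteqP; split=> [_ [x Xx [y Yy <-]]|_ [[x y] [/= Xx Yy] <-]].
    by exists (x, y).
  by exists x => //; exists y.
have [[x y] [/= Xx Yy] [fE fle]] := sup_attained XY0 cXY cf.
exists x, y; split; rewrite ?zE// => x' y' Xx' Yy'.
exact: (fle (x', y')).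
Qed.

(* Main.v *)
(** Fix an optimal pair [(x, y)] and round one side at a time. Against the linear
    objective [w = y >= 0], set coordinate [k] to [theta k / zeta] with
    probability [x k / theta k], independently. Row [j] is violated only if a sum
    of independent loads in [[0, 1]] with mean at most [1] exceeds [zeta], so the
    value lost to the violated rows is at most
    [\sum_j E(V * expR (t * (S j - zeta)))], where [V] is the value and [S j] the
    load of row [j]. By the Chernoff computation this is at most half of [E V]
    when [expR t] is the square root of [ln m], so some outcome is feasible and
    has at least half of the expected value. Rounding [y] against the rounded [x]
    in the same way loses the second factor. *)

Require Import Defs.
From mathcomp Require Import all_boot all_order all_algebra.
From mathcomp Require Import ring lra.
From mathcomp Require Import all_classical all_reals all_analysis.

Set Implicit Arguments.
Unset Strict Implicit.
Unset Printing Implicit Defensive.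

Import Order.TTheory GRing.Theory Num.Theory.
Import numFieldNormedType.Exports.

Local Open Scope classical_set_scope.
Local Open Scope ring_scope.

(** * Convexity of the exponential and averaging *)

(** The tangent to [expR] at [t * c] lies below the graph; averaging its values at [t] and [0] with
    weights [c] and [1 - c] returns the value at the point of tangency. *)
Lemma expR_le_chord (R : realType) (t c : R) :
  0 <= c <= 1 -> expR (t * c) <= 1 + c * (expR t - 1).
Proof.
move=> /andP[c0 c1]; set y := t * c.
have tangent z : expR y * (1 + (z - y)) <= expR z.
  rewrite -[X in _ <= expR X](subrKC y) expRD ler_wpM2l ?expR_ge0//.
  exact: expR_ge1Dx.
have c1' : 0 <= 1 - c by rewrite subr_ge0.
have := lerD (ler_wpM2l c0 (tangent t)) (ler_wpM2l c1' (tangent 0)).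
rewrite expR0.
have -> : c * (expR y * (1 + (t - y))) + (1 - c) * (expR y * (1 + (0 - y)))
  = expR y by rewrite /y; ring.
by have -> : c * expR t + (1 - c) * 1 = 1 + c * (expR t - 1) by ring.
Qed.

Lemma ge_weighted_mean (R : realType) (T : finType) (t0 : T) (mu F : T -> R)
    (z : R) :
  (forall t, 0 <= mu t) -> \sum_t mu t = 1 -> z <= \sum_t mu t * F t ->
  exists t, z <= F t.
Proof.
move=> mu0 mu1 zF; case: (@Order.TotalTheory.arg_maxP _ R _ t0 predT F) => // t _ Ft.
exists t; apply: (le_trans zF); rewrite -[leRHS]mul1r -mu1 mulr_suml.
by apply: ler_sum => s _; rewrite ler_wpM2l//; exact: Ft.
Qed.

(** * Independent Bernoulli coordinates *)

(** Product measure kept as explicit weights, so that every expectation is a finite sum. *)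
Definition bernoulli_weight (R : realType) (n : nat) (a : 'I_n -> R)
    (f : {ffun 'I_n -> bool}) : R :=
  \prod_i (if f i then a i else 1 - a i).

Lemma bernoulli_weight_ge0 (R : realType) (n : nat) (a : 'I_n -> R) f :
  (forall i, 0 <= a i <= 1) -> 0 <= bernoulli_weight a f.
Proof.
move=> a01; apply: prodr_ge0 => i _; have /andP[a0 a1] := a01 i.
by case: ifP; rewrite ?subr_ge0.
Qed.

(** Independence: distributing the product over the two-point sums enumerates all outcomes [f]. *)
Lemma bernoulli_weight_prod (R : realType) (n : nat) (a : 'I_n -> R)
    (h : 'I_n -> bool -> R) :
  \sum_f bernoulli_weight a f * \prod_i h i (f i) =
  \prod_i (a i * h i true + (1 - a i) * h i false).
Proof.
transitivity (\prod_i \sum_b (if b then a i else 1 - a i) * h i b); last first.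
  by apply: eq_bigr => i _; rewrite big_bool.
rewrite bigA_distr_bigA; apply: eq_bigr => f _.
by rewrite big_split.
Qed.

Lemma sum_bernoulli_weight (R : realType) (n : nat) (a : 'I_n -> R) :
  \sum_f bernoulli_weight a f = 1.
Proof.
have := bernoulli_weight_prod a (fun _ _ => 1).
rewrite [RHS]big1 => [<-|i _]; last by ring.
by apply: eq_bigr => f _; rewrite big1 ?mulr1.
Qed.

Lemma bernoulli_weight_coord (R : realType) (n : nat) (a : 'I_n -> R) i :
  \sum_f bernoulli_weight a f * (f i)%:R = a i.
Proof.
have := bernoulli_weight_prod a (fun k b => (if k == i then b else true)%:R).
rewrite [RHS](bigD1 i)//= eqxx mulr1 mulr0 addr0 [X in _ * X]big1 ?mulr1.
  move=> <-; apply: eq_bigr => f _; congr (_ * _).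
  by rewrite (bigD1 i)//= eqxx big1 ?mulr1// => k /negPf ->.
by move=> k /negPf -> /=; ring.
Qed.

(* Conditioning on [f i] costs at most one factor [expR t] in the Chernoff
   bound, because each single load is at most [1]. *)
Lemma chernoff_size_biased (R : realType) (n : nat) (a c : 'I_n -> R) (t : R) i :
  0 <= t -> (forall k, 0 <= a k <= 1) -> (forall k, 0 <= c k <= 1) ->
  \sum_k a k * c k <= 1 ->
  \sum_f bernoulli_weight a f * ((f i)%:R * expR (t * \sum_k c k * (f k)%:R))
    <= a i * expR (t + (expR t - 1)).
Proof.
move=> t0 a01 c01 ac1.
have s0 : 0 <= expR t - 1 by rewrite subr_ge0 -expR0 ler_expR.
pose h k b := (if k == i then b else true)%:R * expR (t * (c k * b%:R)).
rewrite (eq_bigr (fun f => bernoulli_weight a f * \prod_k h k (f k))); last first.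
  move=> f _; congr (_ * _); rewrite /h big_split/=; congr (_ * _).
    by rewrite (bigD1 i)//= eqxx big1 ?mulr1// => k /negPf ->.
  by rewrite mulr_sumr expR_sum.
rewrite bernoulli_weight_prod.
pose g k := (if k == i then a i * expR t else 1) * expR ((expR t - 1) * (a k * c k)).
have -> : a i * expR (t + (expR t - 1)) = a i * expR t * expR (expR t - 1).
  by rewrite expRD mulrA.
apply: (@le_trans _ _ (\prod_k g k)).
  apply: ler_prod => k _; rewrite /h /g mulr0 mulr0 expR0 !mulr1.
  have /andP[ak0 ak1] := a01 k; have /andP[ck0 ck1] := c01 k.
  (* This factor pads the term [k = i], so that the exponents in [g] run over every [k] and sum to
     at most [expR t - 1]. *)
  have e1 : 1 <= expR ((expR t - 1) * (a k * c k)).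
    by rewrite -[leLHS]expR0 ler_expR mulr_ge0// mulr_ge0.
  case: eqP => [<-|_]; rewrite ?mul1r ?mulr0 ?mulr1 ?addr0.
    rewrite mulr_ge0 ?expR_ge0//=.
    rewrite -[leLHS]mulr1 ler_pM ?mulr_ge0 ?expR_ge0// ler_wpM2l// ler_expR.
    by rewrite -[leRHS]mulr1 ler_wpM2l.
  rewrite addr_ge0 ?mulr_ge0 ?expR_ge0 ?subr_ge0//=.
  apply: le_trans (expR_ge1Dx _).
  have := ler_wpM2l ak0 (expR_le_chord t (c01 k)).
  by set e := expR (t * c k); lra.
rewrite /g big_split/= (bigD1 i)//= eqxx big1 ?mulr1 => [|k /negPf ->//].
rewrite -expR_sum -mulr_sumr ler_wpM2l ?mulr_ge0 ?expR_ge0//.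
  by have /andP[] := a01 i.
by rewrite ler_expR -[leRHS]mulr1 ler_wpM2l.
Qed.

(** * Rounding under load constraints *)

(** The last hypothesis says that the Chernoff bounds of the [m] rows add up to at most one half. *)
Lemma randomized_rounding (R : realType) (m n : nat) (a v : 'I_n -> R)
    (c : 'I_m -> 'I_n -> R) (t z : R) :
  0 <= t -> 0 <= z ->
  (forall k, 0 <= a k <= 1) -> (forall k, 0 <= v k) ->
  (forall j k, 0 <= c j k <= 1) -> (forall j, \sum_k a k * c j k <= 1) ->
  m%:R * expR (t + (expR t - 1) - t * z) <= 2^-1 ->
  exists f : {ffun 'I_n -> bool},
    (forall j, \sum_k c j k * (f k)%:R <= z) /\
    (\sum_k v k * a k) / 2 <= \sum_k v k * (f k)%:R.
Proof.
move=> t0 z0 a01 v0 c01 ac1 mz.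
pose V (f : {ffun 'I_n -> bool}) := \sum_k v k * (f k)%:R.
pose S j (f : {ffun 'I_n -> bool}) := \sum_k c j k * (f k)%:R.
pose w := \sum_k v k * a k.
have w0 : 0 <= w.
  by apply: sumr_ge0 => k _; rewrite mulr_ge0//; have /andP[] := a01 k.
(* The final contradiction needs a positive mean; with mean [0] the all-false outcome works. *)
have [w_eq0|w_neq0] := eqVneq w 0.
  exists [ffun=> false]; split=> [j|]; last first.
    rewrite -/w w_eq0 mul0r; apply: sumr_ge0 => k _.
    by rewrite ffunE mulr0.
  by rewrite big1// => k _; rewrite ffunE mulr0.
have w_gt0 : 0 < w by rewrite lt_neqAle eq_sym w_neq0.
(* [F f] is positive only if every row [S j f] is at most [z]. *)
pose F f := V f * (1 - \sum_j expR (t * S j f - t * z)).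
have EV : \sum_f bernoulli_weight a f * V f = w.
  under eq_bigr do rewrite mulr_sumr.
  rewrite exchange_big/=; apply: eq_bigr => k _.
  rewrite -[in RHS](bernoulli_weight_coord a k) mulr_sumr.
  by apply: eq_bigr => f _; ring.
have EVS j : \sum_f bernoulli_weight a f * (V f * expR (t * S j f - t * z))
    <= w * expR (t + (expR t - 1) - t * z).
  rewrite expRD.
  (* Linearity in [V] reduces to one coordinate at a time, where the size-biased bound applies. *)
  under eq_bigr do rewrite expRD /V mulr_suml mulr_sumr.
  rewrite exchange_big/= mulr_suml; apply: ler_sum => k _.
  have := chernoff_size_biased k t0 a01 (c01 j) (ac1 j).
  move/(ler_wpM2l (v0 k)) => /(ler_wpM2l (expR_ge0 (- (t * z)))).
  rewrite !mulr_sumr => H; apply: le_trans (le_trans _ H) _.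
    by apply: ler_sum => f _; rewrite le_eqVlt predU1l//; rewrite /S; ring.
  by rewrite le_eqVlt predU1l//; ring.
have EF : w / 2 <= \sum_f bernoulli_weight a f * F f.
  have -> : \sum_f bernoulli_weight a f * F f =
      w - \sum_j \sum_f bernoulli_weight a f * (V f * expR (t * S j f - t * z)).
    rewrite -EV exchange_big -sumrB; apply: eq_bigr => f _.
    by rewrite -!mulr_sumr /F; ring.
  have : \sum_j \sum_f bernoulli_weight a f * (V f * expR (t * S j f - t * z))
      <= w * 2^-1.
    apply: (le_trans (ler_sum _ (fun j _ => EVS j))).
    by rewrite sumr_const card_ord -[leLHS]mulr_natl mulrCA ler_wpM2l.
  by lra.
have [f Ff] := ge_weighted_mean [ffun=> false]
  (fun f => bernoulli_weight_ge0 f a01) (sum_bernoulli_weight a) EF.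
have V0 : 0 <= V f by apply: sumr_ge0 => k _; rewrite mulr_ge0.
have sum0 : 0 <= \sum_j expR (t * S j f - t * z).
  by apply: sumr_ge0 => j _; exact: expR_ge0.
exists f; split=> [j|]; last first.
  by apply: (le_trans Ff); rewrite -[leRHS]mulr1 ler_wpM2l// gerBl.
rewrite leNgt; apply/negP => zS.
have : 0 < F f by apply: lt_le_trans Ff; rewrite divr_gt0.
apply/negP; rewrite -leNgt mulr_ge0_le0// subr_le0 (bigD1 j)//=.
rewrite -[leLHS]addr0 lerD ?sumr_ge0//.
by rewrite -[leLHS]expR0 ler_expR -mulrBr mulr_ge0// subr_ge0 ltW.
Qed.

(** * Numerical bounds on the scaling *)

Lemma zeta_star_bounds (R : realType) (m : nat) : expR 4 <= m%:R :> R ->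
  [/\ 0 < ln m%:R :> R, 0 < ln (ln m%:R) :> R, 1 <= zeta_star R m,
      zeta_star R m * (ln (ln m%:R) / ln m%:R) <= 5
    & exists2 t : R, 0 <= t &
        m%:R * expR (t + (expR t - 1) - t * zeta_star R m) <= 2^-1].
Proof.
move=> m4; have m0 : 0 < m%:R :> R by apply: lt_le_trans m4; exact: expR_gt0.
rewrite /zeta_star; set L : R := ln m%:R; set l := ln L.
have L4 : 4 <= L by rewrite -ler_expR /L lnK.
have L0 : 0 < L by lra.
have l0 : 0 < l by rewrite ln_gt0//; lra.
have lL : l < L by exact: ln_sublinear.
have d0 : 0 <= L / l by rewrite divr_ge0// ltW.
split=> //.
- by rewrite -mulrA; lra.
- have -> : (3 * L / l + 2) * (l / L) = 3 + 2 * (l / L).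
    by field; rewrite !gt_eqF.
  have : l / L <= 1 by rewrite ler_pdivrMr// mul1r ltW.
  by lra.
(* With [t = l / 2] the tilt [expR t] is the square root of [L]. *)
exists (l / 2); first by lra.
rewrite -[X in X * expR _](lnK m0) -expRD -/L; set s := expR (l / 2).
have sL : s * s = L by rewrite -expRD -splitr lnK.
have s2 : 2 <= s.
  rewrite leNgt; apply/negP => s2; have s0 : 0 < s by exact: expR_gt0.
  by nra.
have -> : l / 2 * (3 * L / l + 2) = 3 / 2 * L + l.
  by field; rewrite gt_eqF.
(* The exponent equals [s - 1 - s * s / 2 - l / 2], at most [-1] since [L >= 4] gives [s >= 2]. *)
apply: (@le_trans _ _ (expR (- 1))); first by rewrite ler_expR; nra.
rewrite expRN lef_pV2 ?posrE ?expR_gt0//.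
by apply: le_trans (expR_ge1Dx _); lra.
Qed.

(** * Rounding one side of the bilinear program *)

Lemma dotcvE (R : realType) (n : nat) (x y : 'cV[R]_n) :
  dotcv x y = \sum_k x k ord0 * y k ord0.
Proof. by rewrite /dotcv mxE; apply: eq_bigr => k _; rewrite mxE. Qed.

(** The factor [10^-1] is [1/2] from the rounding times [1/5] from the upper bound on
    [zeta_star]. *)
Lemma packing_rounding (R : realType) (m n : nat) (P : 'M[R]_(m, n))
    (p : 'cV[R]_m) (w x : 'cV[R]_n) :
  expR 4 <= m%:R :> R -> lemx 0 P -> lemx 0 p -> bounded_set (packing P p) ->
  lemx 0 w -> packing P p x ->
  exists2 u, packing P p u &
    (forall i, u i ord0 = 0 \/
       u i ord0 = coord_max (packing P p) i / zeta_star R m) /\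
    10^-1 * (ln (ln m%:R) / ln m%:R) * dotcv x w <= dotcv u w.
Proof.
move=> m4 P0 p0 bX w0 [x0 xp].
have [L0 l0 z1 zL [t t0 tz]] := zeta_star_bounds m4.
set z := zeta_star R m in z1 zL tz *; set theta := coord_max _.
have {}P0 j k : 0 <= P j k by have := P0 j k; rewrite mxE.
have {}p0' j : 0 <= p j ord0 by have := p0 j ord0; rewrite mxE.
have {}w0 k : 0 <= w k ord0 by have := w0 k ord0; rewrite mxE.
have x_ge0 k : 0 <= x k ord0 by have := x0 k ord0; rewrite mxE.
have xtheta k : x k ord0 <= theta k.
  by have [y _ [_]] := coord_max_attained k p0 bX; apply; split.
have theta0 k : 0 <= theta k := le_trans (x_ge0 k) (xtheta k).
(* A maximiser of coordinate [k] satisfies row [j], whose other terms are nonnegative; this keeps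
   single loads at most [1]. *)
have Ptheta j k : P j k * theta k <= p j ord0.
  have [y [y0 yp] [yE _]] := coord_max_attained k p0 bX; rewrite /theta -yE.
  apply: le_trans (yp j ord0); rewrite mxE (bigD1 k)//= lerDl.
  apply: sumr_ge0 => i _; rewrite mulr_ge0//.
  by have := y0 i ord0; rewrite mxE.
(* If [theta k = 0] or [p j = 0] the quotients below are [0], which is the
   right value since then [x k = 0], respectively [P j k * theta k = 0]. *)
pose a k := x k ord0 / theta k.
pose c j k := P j k * theta k / p j ord0.
have div01 (u v : R) : 0 <= u <= v -> 0 <= u / v <= 1.
  move=> /andP[u0 uv]; have v0 := le_trans u0 uv; rewrite divr_ge0//=.
  have [->|v_neq0] := eqVneq v 0; first by rewrite invr0 mulr0.
  by rewrite ler_pdivrMr ?mul1r// lt_neqAle eq_sym v_neq0.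
have divK (u v : R) : 0 <= u <= v -> u / v * v = u.
  move=> /andP[u0 uv]; have [v_eq0|v_neq0] := eqVneq v 0; last by rewrite divfK.
  by rewrite v_eq0 mulr0; apply/eqP; rewrite eq_le u0 -v_eq0 uv.
have a01 k : 0 <= a k <= 1 by apply: div01; rewrite x_ge0 xtheta.
have atheta k : a k * theta k = x k ord0 by apply: divK; rewrite x_ge0 xtheta.
have Pt01 j k : 0 <= P j k * theta k <= p j ord0 by rewrite mulr_ge0//=.
have c01 j k : 0 <= c j k <= 1 by exact: div01.
have cp j k : c j k * p j ord0 = P j k * theta k by exact: divK.
have ac1 j : \sum_k a k * c j k <= 1.
  (* The mean load of row [j] is its left side at [x] divided by [p j ord0]. *)
  rewrite (eq_bigr (fun k => P j k * x k ord0 / p j ord0)); last first.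
    by move=> k _; rewrite -(atheta k) /c; ring.
  rewrite -mulr_suml.
  have /andP[] // : 0 <= (\sum_k P j k * x k ord0) / p j ord0 <= 1.
  apply: div01; rewrite sumr_ge0/= => [|k _]; last by rewrite mulr_ge0.
  by have := xp j ord0; rewrite mxE.
have z0 : 0 < z by exact: lt_le_trans z1.
have [f [fz fw]] := @randomized_rounding R m n a (fun k => theta k * w k ord0)
  c t z t0 (ltW z0) a01 (fun k => mulr_ge0 (theta0 k) (w0 k)) c01 ac1 tz.
(* Dividing by [z] turns loads of at most [z] into feasibility. *)
pose u : 'cV[R]_n := \col_k (theta k / z * (f k)%:R).
exists u; first split.
- by move=> k j; rewrite !mxE mulr_ge0// divr_ge0// ltW.
- move=> j k; rewrite (ord1 k) mxE.
  rewrite (eq_bigr (fun k => p j ord0 / z * (c j k * (f k)%:R))); last first.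
    move=> i _; transitivity (P j i * theta i * (f i)%:R / z).
      by rewrite mxE; ring.
    by rewrite -cp; ring.
  rewrite -mulr_sumr -[leRHS](divfK (lt0r_neq0 z0)) ler_wpM2l//.
  by rewrite divr_ge0// ltW.
split=> [k|].
  by rewrite mxE; case: (f k); rewrite ?mulr1 ?mulr0; [right|left].
rewrite !dotcvE.
have -> : \sum_k u k ord0 * w k ord0 = (\sum_k theta k * w k ord0 * (f k)%:R) / z.
  by rewrite mulr_suml; apply: eq_bigr => k _; rewrite mxE; ring.
have -> : \sum_k x k ord0 * w k ord0 = \sum_k theta k * w k ord0 * a k.
  by apply: eq_bigr => k _; rewrite -atheta; ring.
rewrite ler_pdivlMr//; apply: le_trans fw.
set s := \sum_k _; have s0 : 0 <= s.
  by apply: sumr_ge0 => k _; rewrite mulr_ge0 ?mulr_ge0 ?invr_ge0.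
have := ler_wpM2l s0 zL; set r := ln _ / _.
have -> : 10^-1 * r * s * z = 10^-1 * (s * (z * r)) by ring.
by lra.
Qed.

Theorem lemma1 (R : realType) :
  exists (c : R) (M : nat), 0 < c /\
  forall (n m1 m2 : nat)
    (P : 'M[R]_(m1, n)) (p : 'cV[R]_m1) (Q : 'M[R]_(m2, n)) (q : 'cV[R]_m2),
    (M <= m1)%N -> (M <= m2)%N ->
    lemx 0 P -> lemx 0 p -> lemx 0 Q -> lemx 0 q ->
    let X := packing P p in
    let Y := packing Q q in
    bounded_set X -> bounded_set Y ->
    exists (x y : 'cV[R]_n) (zeta1 zeta2 : R),
      [/\ X x /\ Y y,
          1 <= zeta1 <= zeta_star R m1 /\ 1 <= zeta2 <= zeta_star R m2,
          forall i : 'I_n, x i ord0 = 0 \/ x i ord0 = coord_max X i / zeta1,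
          forall i : 'I_n, y i ord0 = 0 \/ y i ord0 = coord_max Y i / zeta2
        & c * (ln (ln m1%:R) / ln m1%:R) * (ln (ln m2%:R) / ln m2%:R)
            * zPDB X Y <= dotcv x y].

Proof.
(* Each of the two roundings costs [10^-1]; [M] exceeds [expR 4]. *)
exists (100^-1), (Num.trunc (expR 4 : R)).+1; split; first by rewrite invr_gt0.
move=> n m1 m2 P p Q q Mm1 Mm2 P0 p0 Q0 q0 X Y bX bY.
have large m : ((Num.trunc (expR 4 : R)).+1 <= m)%N -> expR 4 <= m%:R :> R.
  by move=> Mm; rewrite (le_trans (ltW (truncnS_gt _)))// ler_nat.
have [[L1 l1 z1 _ _] [L2 l2 z2 _ _]] :=
  (zeta_star_bounds (large _ Mm1), zeta_star_bounds (large _ Mm2)).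
have [x [y [Xx Yy <- _]]] := zPDB_attained p0 bX q0 bY.
have [u Xu [uE xu]] := packing_rounding (large _ Mm1) P0 p0 bX (proj1 Yy) Xx.
(* The value to match is now [dotcv y u], which [xu] already bounds below, so the two factors
   multiply. *)
have [v Yv [vE yv]] := packing_rounding (large _ Mm2) Q0 q0 bY (proj1 Xu) Yy.
exists u, v, (zeta_star R m1), (zeta_star R m2); split=> //.
  by rewrite z1 z2 !lexx.
have dotC (a b : 'cV[R]_n) : dotcv a b = dotcv b a.
  by rewrite !dotcvE; apply: eq_bigr => k _; rewrite mulrC.
rewrite (dotC u v); apply: le_trans yv; rewrite (dotC y u).
set r1 := _ / ln m1%:R in xu *; set r2 := _ / ln m2%:R.
have r20 : 0 <= 10^-1 * r2 by rewrite mulr_ge0// divr_ge0// ltW.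
apply: le_trans (ler_wpM2l r20 xu).
by rewrite le_eqVlt predU1l//; field.
Qed.
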